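(* Let $\mathcal G$ be a complete multipartite graph with vertex set $\{1,\dots,n\}$ (with $n\ge 2$), and let $W(\mathcal G):=\sum_{\{i,j\}\in E(\mathcal G)}(ij)\in\mathbb C S_n$. Then for every partition $\alpha\neq(n)$ of $n$, $$\lambda_{\max}\bigl[\alpha, W(\mathcal G)\bigr]\le \lambda_{\max}\bigl[(n-1,1), W(\mathcal G)\bigr].$$
   Context: A graph $\mathcal G$ on $\{1,\dots,n\}$ is complete multipartite if $\{1,\dots,n\}$ is a disjoint union of $p\ge 2$ nonempty sets $N_1,\dots,N_p$ such that $\{i,j\}$ is an edge iff $i$ and $j$ lie in distinct $N_k$'s. Each edge $\{i,j\}$ is identified with the transposition $(ij)\in S_n$, so $W(\mathcal G)$ is an element of the complex group algebra $\mathbb C S_n$. For a partition $\alpha$ of $n$, $T^\alpha$ denotes a (unitary) representative of the irreducible complex representation of $S_n$ indexed by $\alpha$ (with $(n)$ the trivial representation), extended linearly to $\mathbb C S_n$; $\lambda_{\max}[\alpha,W(\mathcal G)]$ denotes the largest eigenvalue of the matrix $T^\alpha(W(\mathcal G))=\sum_{\{i,j\}\in E(\mathcal G)}T^\alpha((ij))$ (this does not depend on the choice of representative). *)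

(* Defs.v *)
From HB Require Import structures.
From mathcomp Require Import all_boot all_order all_fingroup all_algebra.
From mathcomp Require Import all_solvable all_field all_character.
From mathcomp Require Import complex.
From mathcomp Require Import reals.

Set Implicit Arguments.
Unset Strict Implicit.
Unset Printing Implicit Defensive.

Import Order.TTheory GRing.Theory Num.Theory.
Local Open Scope ring_scope.

(* The vertex set {1, ..., n} is rendered as 'I_n.  The last clause makes e   *)
(* symmetric and irreflexive.                                                 *)
Definition complete_multipartite (n : nat) (e : rel 'I_n) : Prop :=
  exists P : {set {set 'I_n}},
    [/\ partition P [set: 'I_n], (2 <= #|P|)%N
      & forall i j : 'I_n, e i j = (pblock P i != pblock P j)].

Definition is_intpart (n : nat) (a : seq nat) : bool :=
  [&& sorted geq a, 0%N \notin a & sumn a == n].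

Section Representations.

Variables (F : fieldType) (n : nat).

Local Notation Sn := [set: {perm 'I_n}]%G.
Local Notation aG := (regular_repr F Sn).

(* The group algebra F[S_n] is represented, as in mxrepresentation, by the    *)
(* matrices of its action on itself by right multiplication: the group        *)
(* element s is aG s.  Each unordered edge {i, j} is counted once, as the     *)
(* pair with i < j.                                                           *)
Definition W (e : rel 'I_n) : 'M[F]_#|Sn| :=
  \sum_(i < n) \sum_(j < n | (i < j)%N && e i j) aG (tperm i j).

(* Row and column of the entry i in the tableau of shape a in which           *)
(* 0, 1, ..., n-1 are written row by row, from left to right: the cell (r, c) *)
(* has r = reshape_index a i and c = reshape_offset a i.                      *)
Definition row_stab (a : seq nat) : {set {perm 'I_n}} :=
  [set s : {perm 'I_n} |
    [forall i : 'I_n, reshape_index a (s i) == reshape_index a i]].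

Definition col_stab (a : seq nat) : {set {perm 'I_n}} :=
  [set s : {perm 'I_n} |
    [forall i : 'I_n, reshape_offset a (s i) == reshape_offset a i]].

Definition young_symmetrizer (a : seq nat) : 'M[F]_#|Sn| :=
  (\sum_(s in row_stab a) aG s)
    *m (\sum_(s in col_stab a) (-1) ^+ odd_perm s *: aG s).

(* The Specht module of shape a, i.e., the right ideal c_a F[S_n] generated   *)
(* by the Young symmetrizer c_a; for a = (n) it is the trivial module.        *)
Definition specht_mx (a : seq nat) : 'M[F]_#|Sn| :=
  cyclic_mx aG (gring_row (young_symmetrizer a)).

Lemma specht_mx_module (a : seq nat) : mxmodule aG (specht_mx a).
Proof. exact: cyclic_mx_module. Qed.

Definition specht_repr (a : seq nat) :
    mx_representation F Sn (\rank (specht_mx a)) :=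
  submod_repr (specht_mx_module a).

Definition irrep_of_shape (a : seq nat) (d : nat)
    (T : mx_representation F Sn d) : Prop :=
  mx_rsim T (specht_repr a).

End Representations.

(* The order of R[i] is partial: x <= y iff y - x is real and nonnegative, so *)
(* the second clause says that the spectrum of A is real and bounded by l.    *)
Definition is_lambda_max (R : realType) (d : nat) (A : 'M[R[i]]_d) (l : R) :
    Prop :=
  eigenvalue A l%:C%C /\ forall z : R[i], eigenvalue A z -> z <= l%:C%C.

(* Main.v *)
Require Import Defs.
From mathcomp Require Import all_boot all_order all_fingroup all_algebra.
From mathcomp Require Import all_solvable all_field all_character.
From mathcomp Require Import complex reals.

(**
Write D for the Laplacian, the sum of 1 - (ij) over the edges, so that
W = |E| - D, and let V be a unitary representation of S_n without nonzero
invariants. Two facts on the Jucys-Murphy element X = sum_(b in B) (b x) suffice: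
on vectors invariant under Sym(B) but killed by the average over Sym(B + x) it is
-1, and on vectors killed by the average over Sym(B) it is at most |B| - 1. The
latter is proved by induction on |B|, moving an eigenvalue of X down to the
previous Jucys-Murphy element through the degenerate affine Hecke relation.

Consequently the Laplacian of the complete graph is at least n on V. For a complete
multipartite graph, the average over the symmetric group of a part N commutes with
D. On the vectors killed by it, each of the n - |N| stars joining N to an outside
vertex contributes at least 1, so D >= n - |N|; on the vectors invariant under all
the parts, D is the Laplacian of the complete graph, so D >= n. The Specht module
of shape (n-1,1) contains the vectors e_i - e_j of the natural representation, and
with i, j in a largest part (or arbitrary, for the complete graph) they attain the
bound.
*)

Set Implicit Arguments.
Unset Strict Implicit.
Unset Printing Implicit Defensive.

Import Order.TTheory GRing.Theory Num.Theory.
Local Open Scope ring_scope.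
Local Open Scope sesquilinear_scope.

(** * Quadratic forms and eigenvectors of Hermitian matrices *)

Section HermitianMatrices.

Variables (C : numClosedFieldType) (N : nat).
Implicit Types (A Y : 'M[C]_N) (u v : 'rV[C]_N).

Lemma dotmx_adj u v A : dotmx (u *m A) v = dotmx u (v *m A^t*).
Proof. by rewrite !dotmxE trmx_mul map_mxM trmxCK mulmxA. Qed.

Lemma dotmxDl u v w : dotmx (u + v) w = dotmx u w + dotmx v w.
Proof. exact: linearDl. Qed.

Lemma dotmxDr u v w : dotmx w (u + v) = dotmx w u + dotmx w v.
Proof. exact: linearDr. Qed.

Lemma dotmxBl u v w : dotmx (u - v) w = dotmx u w - dotmx v w.
Proof. exact: linearBl. Qed.

Lemma dotmxZl a u v : dotmx (a *: u) v = a * dotmx u v.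
Proof. exact: linearZl_LR. Qed.

Lemma dotmx_suml (I : finType) (P : pred I) (f : I -> 'rV[C]_N) v :
  dotmx (\sum_(i | P i) f i) v = \sum_(i | P i) dotmx (f i) v.
Proof.
have D u w : dotmx (u + w) v = dotmx u v + dotmx w v by apply: dotmxDl.
by apply: (big_morph _ D); apply: linear0l.
Qed.

(** By the spectral theorem, in a unitary eigenbasis the form is the sum of the eigenvalues weighted
    by squared moduli of coordinates. *)
Lemma dotmx_mul_ge0 A : A^t* = A ->
  (forall v l, v != 0 -> v *m A = l *: v -> 0 <= l) ->
  forall u, 0 <= dotmx (u *m A) u.
Proof.
move=> Ah Apos u.
have An : A \is normalmx by apply/normalmxP; rewrite Ah.
have /orthomx_spectralP := An.
set P := spectralmx A; set sp := spectral_diag A => Aeq.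
have Pu : P \in unitmx by apply: spectral_unit.
have PP : P \is unitarymx by apply: spectral_unitarymx.
have PA : P *m A = diag_mx sp *m P.
  by rewrite Aeq !mulmxA mulmxV // mul1mx.
have sp_ge0 i : 0 <= sp 0 i.
  apply: (Apos (row i P)).
    apply/eqP => Pi0; have /row_unitarymxP/(_ i i) := PP.
    by rewrite Pi0 dotmxE mul0mx mxE eqxx => /eqP; rewrite eq_sym oner_eq0.
  by rewrite -row_mul PA row_mul row_diag_mx -scalemxAl -rowE.
rewrite dotmxE Aeq invmx_unitary //.
have -> : u *m (P^t* *m diag_mx sp *m P) *m u^t* =
    (u *m P^t*) *m diag_mx sp *m (u *m P^t*)^t*.
  by rewrite trmx_mul map_mxM trmxCK !mulmxA.
set w := u *m P^t*; rewrite mxE; apply: sumr_ge0 => j _.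
rewrite mul_mx_diag !mxE mulrAC mulr_ge0 ?mul_conjC_ge0 //.
Qed.

(** [P] is an orthogonal projection commuting with [L], so its image and its kernel are orthogonal
    and [L]-stable, and the cross terms vanish. *)
Lemma dotmx_split (P L : 'M[C]_N) u : P^t* = P -> P *m P = P -> P *m L = L *m P ->
  dotmx (u *m L) u = dotmx (u *m P *m L) (u *m P) +
                     dotmx ((u - u *m P) *m L) (u - u *m P).
Proof.
move=> adjP PP PL; set u1 := u *m P; set u2 := u - u1.
have u1E : u1 = u *m P^t* by rewrite adjP.
have u2P : u2 *m P = 0 by rewrite mulmxBl -[u1 *m P]mulmxA PP subrr.
have u2L : dotmx (u2 *m L) u1 = 0.
  by rewrite u1E -dotmx_adj -mulmxA -PL mulmxA u2P mul0mx linear0l.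
have u1L : dotmx (u1 *m L) u2 = 0.
  have -> : u1 *m L = u1 *m L *m P by rewrite -mulmxA -PL mulmxA -[u1 *m P]mulmxA PP.
  by rewrite dotmx_adj adjP u2P linear0r.
have uE : u = u1 + u2 by rewrite addrC subrK.
clearbody u2 u1; rewrite {1 2}uE mulmxDl dotmxDl !dotmxDr u2L u1L.
by rewrite addr0 add0r.
Qed.

(** [Y] restricts to the nonzero left kernel of [K] and has an eigenvalue there. Giving the subspace
    as a kernel lets several linear conditions be joined by [row_mx]. *)
Lemma stable_kermx_eigenvector p (K : 'M[C]_(N, p)) Y v :
    v != 0 -> v *m K = 0 -> (forall u, u *m K = 0 -> u *m Y *m K = 0) ->
  exists (w : 'rV[C]_N) a, [/\ w != 0, w *m K = 0 & w *m Y = a *: w].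
Proof.
move=> v0 vK stabK; pose B := row_base (kermx K).
have BK : B *m K = 0 by apply/sub_kermxP; rewrite eq_row_base.
have BY : (B *m Y <= B)%MS.
  rewrite eq_row_base; apply/sub_kermxP/row_matrixP=> i.
  by rewrite row_mul row_mul row0 stabK // -row_mul BK row0.
have rk : (0 < \rank (kermx K))%N.
  rewrite lt0n mxrank_eq0; apply: contraNneq v0 => K0.
  by rewrite -submx0 -K0; apply/sub_kermxP.
have [a /eigenvalueP [w wE w0]] := eigenvalue_closed (B *m Y *m pinvmx B) rk.
exists (w *m B), a; split; first by rewrite mulmx_free_eq0 ?row_base_free.
  by rewrite -mulmxA BK mulmx0.
by rewrite -mulmxA -(mulmxKpV BY) mulmxA wE scalemxAl.
Qed.

End HermitianMatrices.

(** * Symmetric averages and Jucys-Murphy elements in a unitary representation *)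

Section SymmetricGroup.

Variables (C : numClosedFieldType) (T : finType) (N : nat).
Variable rG : mx_representation C [set: {perm T}]%G N.
Hypothesis rG_adj : forall s, (rG s)^t* = rG s^-1%g.
Implicit Types (s t : {perm T}) (A B : {set T}) (x c : T) (u v : 'rV[C]_N).

Lemma reprM s t : rG (s * t)%g = rG s *m rG t.
Proof. by rewrite repr_mxM ?inE. Qed.

(** The orthogonal projection onto the vectors invariant under the permutations supported in [B]. *)
Definition symavg B : 'M[C]_N := #|perm.Sym B|%:R^-1 *: \sum_(s in perm.Sym B) rG s.

Definition jucys_murphy x B : 'M[C]_N := \sum_(b in B) rG (tperm b x).

Let cardS_neq0 B : #|perm.Sym B|%:R != 0 :> C.
Proof. by rewrite pnatr_eq0 -lt0n cardG_gt0. Qed.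

Lemma mul_symavg B s : s \in perm.Sym B -> rG s *m symavg B = symavg B.
Proof.
move=> Bs; rewrite -scalemxAr mulmx_sumr; congr (_ *: _).
rewrite [RHS](reindex_inj (mulgI s)) /=.
by apply: eq_big => [t|t _]; rewrite ?groupMl // reprM.
Qed.

Lemma symavg_fixed B u :
  (forall s, s \in perm.Sym B -> u *m rG s = u) -> u *m symavg B = u.
Proof.
move=> fix_u; rewrite -scalemxAr mulmx_sumr (eq_bigr _ fix_u) sumr_const.
by rewrite -scaler_nat scalerA mulVf ?cardS_neq0 // scale1r.
Qed.

Lemma symavg_adj B : (symavg B)^t* = symavg B.
Proof.
rewrite /symavg linearZ /= map_mxZ fmorphV rmorph_nat; congr (_ *: _).
rewrite linear_sum raddf_sum /= (reindex_inj invg_inj) /=.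
apply: eq_big => [s|s _]; rewrite ?groupV //.
by have := rG_adj s^-1%g; rewrite invgK.
Qed.

Lemma symavg_mul B s : s \in perm.Sym B -> symavg B *m rG s = symavg B.
Proof.
move=> Bs; rewrite -scalemxAl mulmx_suml; congr (_ *: _).
rewrite [RHS](reindex_inj (mulIg s)) /=.
by apply: eq_big => [t|t _]; rewrite ?groupMr // reprM.
Qed.

Lemma symavgM A B : A \subset B -> symavg A *m symavg B = symavg B.
Proof.
move=> /subsetP sAB; rewrite {1}/symavg -scalemxAl mulmx_suml.
rewrite (eq_bigr (fun=> symavg B)) => [|s]; last first.
  rewrite inE => sA; apply: mul_symavg; rewrite inE.
  by apply/subsetP=> y /(subsetP sA)/sAB.
by rewrite sumr_const -scaler_nat scalerA mulVf ?cardS_neq0 // scale1r.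
Qed.

Lemma symavg_comm B (M : 'M[C]_N) :
    (forall s, s \in perm.Sym B -> rG s *m M = M *m rG s) ->
  symavg B *m M = M *m symavg B.
Proof.
move=> cM; rewrite -scalemxAl -scalemxAr mulmx_suml mulmx_sumr.
by rewrite (eq_bigr _ cM).
Qed.

Lemma jucys_murphy_comm x B s : x \notin B -> s \in perm.Sym B ->
  rG s *m jucys_murphy x B = jucys_murphy x B *m rG s.
Proof.
rewrite inE => Bx sB; rewrite mulmx_sumr mulmx_suml.
rewrite (reindex_inj (@perm_inj _ s)) /=.
apply: eq_big => [b|b _]; first exact: perm_closed.
by rewrite -!reprM [in RHS]conjgC tpermJ (out_perm sB Bx).
Qed.

Lemma tperm_Sym B x c : x \in B -> c \in B -> tperm x c \in perm.Sym B.
Proof.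
move=> Bx Bc; rewrite inE; apply/subsetP=> y; rewrite inE.
by case: tpermP => [-> //|-> //|_ _]; rewrite eqxx.
Qed.

(** The transpositions [tperm b c], with the identity for [b = c], represent the cosets of Sym(B) in
    Sym(B + c). Hence [v] plus its image is invariant under the larger group, so it equals its own
    average, which is a multiple of that of [v], namely 0. *)
Lemma jucys_murphy_fixed B c v : c \notin B ->
    (forall s, s \in perm.Sym B -> v *m rG s = v) -> v *m symavg (c |: B) = 0 ->
  v *m jucys_murphy c B = - v.
Proof.
move=> Bc fix_v vcB; apply/eqP; rewrite -addr_eq0 addrC; apply/eqP.
have -> : v + v *m jucys_murphy c B = \sum_(b in c |: B) v *m rG (tperm b c).
  rewrite big_setU1 //= tperm1 repr_mx1 mulmx1 mulmx_sumr; congr (_ + _).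
set w := \sum_(b in _) _.
have <- : w *m symavg (c |: B) = w.
  apply: symavg_fixed => s cBs; rewrite mulmx_suml.
  rewrite [RHS](reindex_inj (@perm_inj _ s)) /=.
  have [cB cBs'] : c \in c |: B /\ perm_on (c |: B) s
    by rewrite setU11; rewrite inE in cBs.
  apply: eq_big => [b|b Bb]; first by rewrite (perm_closed _ cBs').
  have sBb : s b \in c |: B by rewrite (perm_closed _ cBs').
  (* The inserted product sends [c] to [b], to [s b] and back to [c], so it lies in Sym(B) and fixes
     [v]; thus [s] permutes the summands. *)
  rewrite -mulmxA -reprM -[in RHS](fix_v (tperm b c * s * tperm (s b) c)%g).
    by rewrite -mulmxA -reprM -mulgA tperm2 mulg1.
  rewrite inE; apply/subsetP=> y; rewrite inE.
  have Sy : perm_on (c |: B) (tperm b c * s * tperm (s b) c)%g.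
    have := groupM (groupM (tperm_Sym Bb cB) cBs) (tperm_Sym sBb cB).
    by rewrite inE.
  have [->|yc] := eqVneq y c; first by rewrite !permM tpermR tpermL eqxx.
  by move/(subsetP Sy); rewrite !inE (negPf yc).
rewrite mulmx_suml big1 // => b Bb.
by rewrite -mulmxA mul_symavg // tperm_Sym ?setU11.
Qed.

(** With [t] a Hermitian involution, 1 - t is Hermitian with square 2(1 - t), so the form is half a
    squared norm. *)
Lemma dotmx_tperm_ge0 i j v : 0 <= dotmx (v - v *m rG (tperm i j)) v.
Proof.
set t := rG _; have tt : t *m t = 1%:M.
  by rewrite -reprM tperm2 repr_mx1.
have tadj : t^t* = t by rewrite /t rG_adj tpermV.
have E : dotmx (v - v *m t) (v - v *m t) = 2 * dotmx (v - v *m t) v.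
  have -> : v - v *m t = v *m (1%:M - t) by rewrite mulmxBr mulmx1.
  have E2 : (1%:M - t)^t* = 1%:M - t by rewrite linearB /= map_mxB trmx1 map_mx1 tadj.
  have sq : (1%:M - t) *m (1%:M - t) = 2 *: (1%:M - t).
    by rewrite mulmxBl !mulmxBr tt !(mul1mx, mulmx1) opprB scaler_nat.
  by rewrite -{2}E2 -dotmx_adj -mulmxA sq -scalemxAr dotmxZl.
by rewrite -(pmulr_rge0 _ (ltr0n C 2)) -E dnorm_ge0.
Qed.

Lemma jucys_murphy_le_card x B v b : v != 0 ->
  v *m jucys_murphy x B = b *: v -> b <= #|B|%:R.
Proof.
move=> v0 vb; have v_gt0 : 0 < dotmx v v by rewrite dnorm_gt0.
rewrite -subr_ge0 -(pmulr_lge0 _ v_gt0) mulrBl -[b * _]dotmxZl -vb mulmx_sumr dotmx_suml.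
rewrite mulr_natl -sumr_const -sumrB; apply: sumr_ge0 => i _.
by rewrite -dotmxBl dotmx_tperm_ge0.
Qed.

(** Conjugation by [tperm x c] carries [tperm b c] to [tperm b x]; the summand left over is
    [tperm x c] itself. *)
Lemma jucys_murphy_swap x c B : x \notin B -> c \notin B -> x != c ->
  jucys_murphy x (c |: B) =
    rG (tperm x c) *m jucys_murphy c B *m rG (tperm x c) + rG (tperm x c).
Proof.
move=> Bx Bc xc; rewrite /jucys_murphy big_setU1 //= addrC tpermC; congr (_ + _).
rewrite mulmx_sumr mulmx_suml; apply: eq_bigr => b Bb.
rewrite -!reprM -[X in (X * _ * _)%g]tpermV -mulgA -conjgE tpermJ tpermR tpermD //.
  by apply: contraNneq Bx => ->.
by apply: contraNneq Bc => ->.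
Qed.

(* The vector [w] comes from the degenerate affine Hecke relation              *)
(* [jucys_murphy_swap]; it vanishes only if [b - a] is 1 or -1.                *)
Lemma jucys_murphy_exchange x c B v a b :
    x \notin B -> c \notin B -> x != c -> v != 0 ->
    v *m jucys_murphy c B = a *: v -> v *m jucys_murphy x (c |: B) = b *: v ->
  let w := (b - a) *: (v *m rG (tperm x c)) - v in
  b <= a + 1 \/ w != 0 /\ w *m jucys_murphy c B = b *: w.
Proof.
move=> Bx Bc xc v0 va vb; set s := rG _; set w := _ - v => /=.
have ss : s *m s = 1%:M by rewrite -reprM tperm2 repr_mx1.
(* With Y and Z the elements of [c] and [x], the relation Z = sYs + s multiplied by s on the right
   reads sY = Zs - 1. *)
have vsY : v *m s *m jucys_murphy c B = b *: (v *m s) - v.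
  rewrite scalemxAl -vb jucys_murphy_swap // -/s mulmxDr mulmxDl.
  by rewrite !mulmxA -![_ *m s *m s]mulmxA ss !mulmx1 addrK.
have [w0|w0] := eqVneq w 0; last first.
  right; split=> //; rewrite mulmxBl -scalemxAl vsY va !scalerBr !scalerA [b * (b - a)]mulrC.
  by rewrite -addrA -opprD -scalerDl subrK.
left; have vE : (b - a) *: (v *m s) = v by apply/eqP; rewrite -subr_eq0 -/w w0.
have vs : v *m s = (b - a) *: v by rewrite -{1}vE -scalemxAl -mulmxA ss mulmx1.
have: ((b - a) ^+ 2 - 1) *: v = 0.
  by rewrite scalerBl scale1r expr2 -scalerA -vs vE subrr.
move/eqP; rewrite scaler_eq0 (negPf v0) orbF subr_eq0 sqrf_eq1.
case/orP=> /eqP E; rewrite -[b](subrK a) E addrC lerD2l //.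
by rewrite (le_trans (lerN10 _)) ?ler01.
Qed.

(** Remove a point [c] from [B] to get [B'], and compare with the element of [c] over [B'] through
    [jucys_murphy_exchange]. Either [b] exceeds the eigenvalue [a] of that element by at most 1, or
    [b] is an eigenvalue of it too; the goal is then [b <= #|B'|]. *)
Lemma jucys_murphy_eigen_le x B v b : x \notin B -> v != 0 ->
    v *m symavg B = 0 -> v *m jucys_murphy x B = b *: v ->
  b <= #|B|%:R - 1.
Proof.
have [k] := ubnP #|B|; elim: k => // k IHk in x B v b *; rewrite ltnS => Bk Bx v0 vB vb.
have [B0|[c Bc]] := set_0Vmem B.
  case/eqP: v0; rewrite -vB symavg_fixed // => s; rewrite inE B0 => s0.
  by rewrite (perm_on_id s0) ?cards0 // repr_mx1 mulmx1.
pose B' := B :\ c; have B'c : c \notin B' by rewrite !inE eqxx.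
have B'x : x \notin B' by rewrite !inE (negPf Bx) andbF.
have xc : x != c by apply: contraNneq Bx => ->.
have BE : B = c |: B' by rewrite setD1K.
have cardB : #|B| = #|B'|.+1 by rewrite (cardsD1 c) Bc.
have sB'B s : s \in perm.Sym B' -> s \in perm.Sym B.
  by rewrite !inE => sB'; apply: (subset_trans sB'); rewrite subsetDl.
rewrite cardB mulrS addrC addrK.
have PZ := symavg_comm (fun s sB' => jucys_murphy_comm Bx (sB'B s sB')).
have PY := symavg_comm (fun s => @jucys_murphy_comm c B' s B'c).
(* As [tperm x c] moves only points outside [B'], the exchanged vector stays in the kernel of
   [symavg B'], where induction applies. *)
have Ps : symavg B' *m rG (tperm x c) = rG (tperm x c) *m symavg B'.
  apply: symavg_comm => s; rewrite inE => sB'; rewrite -!reprM; congr (rG _).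
  apply: (perm_onC sB' (tperm_on x c)); rewrite disjoint_sym disjoints_subset.
  by apply/subsetP=> y; rewrite !inE => /pred2P[]->; rewrite ?eqxx ?(negPf Bx) ?andbF.
have [vB'|vB'] := eqVneq (v *m symavg B') 0.
  (* The kernel of [K] is the [b]-eigenspace inside the kernel of [symavg B']. It is stable under
     the commuting element of [c], so a joint eigenvector exists. *)
  pose K := row_mx (jucys_murphy x B - b%:M) (symavg B').
  have [||w [a [w0 wK wa]]] := @stable_kermx_eigenvector _ _ _ K (jucys_murphy c B') v v0.
  - by rewrite mul_mx_row mulmxBr mul_mx_scalar vb vB' subrr row_mx0.
  - move=> u /eqP; rewrite !mul_mx_row row_mx_eq0 => /andP[/eqP uZ /eqP uB'].
    apply/eqP; rewrite row_mx_eq0.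
    rewrite -[_ *m _ *m symavg _]mulmxA -PY mulmxA uB' mul0mx eqxx andbT.
    have YZ : jucys_murphy c B' *m jucys_murphy x B =
              jucys_murphy x B *m jucys_murphy c B'.
      rewrite mulmx_suml mulmx_sumr; apply: eq_bigr => y B'y.
      by rewrite jucys_murphy_comm // tperm_Sym // (subsetP (subsetDl _ _) _ B'y).
    rewrite -mulmxA mulmxBr mul_mx_scalar YZ -mul_scalar_mx -mulmxBl mulmxA uZ.
    by rewrite mul0mx.
  move: wK => /eqP; rewrite mul_mx_row row_mx_eq0 => /andP[wZ /eqP wB'].
  move: wZ; rewrite mulmxBr mul_mx_scalar subr_eq0 BE => /eqP wb.
  have a_le : a <= #|B'|%:R - 1 by apply: (IHk c B' w) => //; rewrite -cardB.
  have := jucys_murphy_exchange B'x B'c xc w0 wa wb => /=.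
  case=> [/le_trans -> //|[w'0 w'b]].
    by rewrite -lerBrDr.
  apply: le_trans (_ : b <= #|B'|%:R - 1) _; last by rewrite gerBl ler01.
  apply: IHk w'b => //; first by rewrite -cardB.
  by rewrite mulmxBl -scalemxAl -mulmxA -Ps mulmxA wB' mul0mx scaler0 subr0.
(* This vector is invariant under Sym(B') but killed by the average over [B], so [a = -1]: the
   exchange gives [b <= 0] or the trivial bound [b <= #|B'|]. *)
pose w := v *m symavg B'.
have wb : w *m jucys_murphy x (c |: B') = b *: w.
  by rewrite -BE -mulmxA PZ mulmxA vb scalemxAl.
have wa : w *m jucys_murphy c B' = (- 1) *: w.
  rewrite scaleN1r; apply: jucys_murphy_fixed => // [s sB'|].
    by rewrite -mulmxA symavg_mul.
  by rewrite -mulmxA symavgM ?subsetUr // -BE vB.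
have := jucys_murphy_exchange B'x B'c xc vB' wa wb => /=.
case=> [|[w'0 w'b]]; last exact: jucys_murphy_le_card w'b.
by rewrite addNr => /le_trans-> //; rewrite ler0n.
Qed.

(** * Laplacians of stars, complete graphs and complete multipartite graphs *)

Definition star_laplacian x B : 'M[C]_N := \sum_(b in B) (1%:M - rG (tperm b x)).

Lemma star_laplacianE x B : star_laplacian x B = #|B|%:R%:M - jucys_murphy x B.
Proof.
by rewrite /star_laplacian sumrB sumr_const -[in RHS]scalemx1 scaler_nat.
Qed.

Lemma repr_tperm_adj x c : (rG (tperm x c))^t* = rG (tperm x c).
Proof. by rewrite rG_adj tpermV. Qed.

Lemma jucys_murphy_adj x B : (jucys_murphy x B)^t* = jucys_murphy x B.
Proof.
rewrite /jucys_murphy linear_sum raddf_sum /=.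
by apply: eq_bigr => b _; apply: repr_tperm_adj.
Qed.

(** [Q] projects onto the kernel of [symavg B] and commutes with [M]. An eigenvector of [Q *m M]
    with nonzero eigenvalue lies in that kernel, so the Jucys-Murphy bound makes the eigenvalue
    nonnegative, and the spectral theorem passes this to the form. *)
Lemma star_laplacian_ge1 x B v : x \notin B -> v *m symavg B = 0 ->
  dotmx v v <= dotmx (v *m star_laplacian x B) v.
Proof.
move=> Bx vB; pose Q := 1%:M - symavg B.
have QQ : Q *m Q = Q.
  by rewrite mulmxBl mul1mx mulmxBr mulmx1 symavgM // subrr subr0.
have vQ : v *m Q = v by rewrite mulmxBr mulmx1 vB subr0.
pose M := star_laplacian x B - 1%:M.
have ME : M = (#|B|%:R - 1)%:M - jucys_murphy x B.
  by rewrite /M star_laplacianE raddfB /= addrAC.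
have QM : Q *m M = M *m Q.
  rewrite [LHS]mulmxBl [RHS]mulmxBr mul1mx mulmx1; congr (_ - _).
  rewrite ME [LHS]mulmxBr [RHS]mulmxBl mul_mx_scalar mul_scalar_mx; congr (_ - _).
  exact: (symavg_comm (fun s => @jucys_murphy_comm x B s Bx)).
have adjQ : Q^t* = Q by rewrite linearB /= map_mxB trmx1 map_mx1 symavg_adj.
have adjM : M^t* = M.
  by rewrite ME linearB /= map_mxB jucys_murphy_adj tr_scalar_mx map_scalar_mx
    /= rmorphB rmorph_nat rmorph1.
rewrite -subr_ge0 -dotmxBl.
have -> : v *m star_laplacian x B - v = v *m (Q *m M).
  by rewrite mulmxA vQ mulmxBr mulmx1.
apply: dotmx_mul_ge0 => [|w l w0 wl].
  by rewrite trmx_mul map_mxM adjQ adjM.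
have [-> // | l0] := eqVneq l 0.
have wQ : w *m Q = w.
  have : w *m (Q *m M) *m Q = l *: (w *m Q) by rewrite wl scalemxAl.
  rewrite -!mulmxA -QM [Q *m (Q *m M)]mulmxA QQ wl.
  by move=> /(scalerI l0).
have wB : w *m symavg B = 0.
  by rewrite -wQ -mulmxA [Q *m _]mulmxBl mul1mx symavgM // subrr mulmx0.
have wM : w *m jucys_murphy x B = (#|B|%:R - 1 - l) *: w.
  by rewrite scalerBl -wl mulmxA wQ ME mulmxBr mul_mx_scalar subKr.
by have := jucys_murphy_eigen_le Bx w0 wB wM; rewrite gerBl.
Qed.

Lemma symavg_small B : (#|B| <= 1)%N -> symavg B = 1%:M.
Proof.
move=> B1; rewrite -[LHS]mul1mx; apply/row_matrixP=> i; rewrite row_mul.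
apply: symavg_fixed => s; rewrite inE => sB.
by rewrite (perm_on_id sB B1) repr_mx1 mulmx1.
Qed.

Lemma star_laplacianJ x B s :
  star_laplacian x B *m rG s = rG s *m star_laplacian (s x) (s @: B).
Proof.
rewrite mulmx_sumr mulmx_suml big_imset => [|a b _ _ /perm_inj //] /=.
apply: eq_bigr => b _; rewrite mulmxBl mulmxBr mulmx1 mul1mx -!reprM.
by rewrite [in LHS]conjgC tpermJ.
Qed.

Lemma star_laplacianU1 x y B : y \notin B ->
  star_laplacian x (y |: B) = 1%:M - rG (tperm y x) + star_laplacian x B.
Proof. by move=> By; rewrite /star_laplacian big_setU1. Qed.

(* Every edge of the complete graph on [A] occurs twice in the sum. *)
Definition clique_laplacian A : 'M[C]_N := \sum_(x in A) star_laplacian x A.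

Lemma clique_laplacian_comm A s : s \in perm.Sym A ->
  rG s *m clique_laplacian A = clique_laplacian A *m rG s.
Proof.
rewrite inE => sA; rewrite mulmx_sumr mulmx_suml.
rewrite (reindex_inj (@perm_inj _ s)) /=.
apply: eq_big => [x|x _]; first exact: perm_closed.
by rewrite star_laplacianJ (im_perm_on sA).
Qed.

Lemma clique_laplacianU1 x B : x \notin B ->
  clique_laplacian (x |: B) = clique_laplacian B + 2 *: star_laplacian x B.
Proof.
move=> Bx; rewrite /clique_laplacian big_setU1 //= star_laplacianU1 //.
rewrite tperm1 repr_mx1 subrr add0r.
under eq_bigr => y _ do rewrite star_laplacianU1 //.
rewrite big_split /= addrA addrC scaler_nat mulr2n; congr (_ + (_ + _)).
by apply: eq_bigr => y _; rewrite tpermC.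
Qed.

(** Induction on [A], removing [x] and splitting [v] by the average over the rest [B]. On the killed
    part induction gives 2|B| and the star at [x], counted twice, at least 2 more; on the invariant
    part only that star acts, by exactly 2(|B| + 1). *)
Lemma clique_laplacian_ge A v : v *m symavg A = 0 ->
  (2 * #|A|)%:R * dotmx v v <= dotmx (v *m clique_laplacian A) v.
Proof.
have [k] := ubnP #|A|; elim: k => // k IHk in A v *; rewrite ltnS => Ak vA.
have [A0|[x Ax]] := set_0Vmem A.
  move: vA; rewrite symavg_small ?A0 ?cards0 // mulmx1 => ->.
  by rewrite mul0mx !linear0l mulr0.
pose B := A :\ x; have Bx : x \notin B by rewrite !inE eqxx.
have AE : A = x |: B by rewrite setD1K.
have cardA : #|A| = #|B|.+1 by rewrite (cardsD1 x) Ax.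
have sBA : B \subset A by apply: subsetDl.
have PL : symavg B *m clique_laplacian A = clique_laplacian A *m symavg B.
  apply: symavg_comm => s; rewrite inE => sB; apply: clique_laplacian_comm.
  by rewrite inE; apply: subset_trans sB sBA.
have PP := symavgM (subxx B).
rewrite (dotmx_split v (symavg_adj B) PP PL).
have -> : dotmx v v = dotmx (v *m 1%:M) v by rewrite mulmx1.
rewrite (dotmx_split v (symavg_adj B) PP (comm_mx1 _)) !mulmx1 mulrDr.
apply: lerD; last first.
  set w := v - _; have wB : w *m symavg B = 0.
    by rewrite mulmxBl -[_ *m _ *m _]mulmxA PP subrr.
  clearbody w; rewrite AE clique_laplacianU1 // -AE mulmxDr dotmxDl -scalemxAr dotmxZl.
  rewrite cardA mulnSr natrD mulrDl lerD ?IHk -?cardA //.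
  by rewrite ler_wpM2l ?ler0n // star_laplacian_ge1.
set w := v *m _.
have wfix s : s \in perm.Sym B -> w *m rG s = w.
  by move=> sB; rewrite -mulmxA symavg_mul.
have wA : w *m symavg A = 0 by rewrite -mulmxA symavgM.
clearbody w; suff -> : w *m clique_laplacian A = (2 * #|A|)%:R *: w by rewrite dotmxZl.
rewrite AE clique_laplacianU1 // -AE mulmxDr mulmx_sumr big1 ?add0r.
  rewrite -scalemxAr star_laplacianE mulmxBr jucys_murphy_fixed //.
    rewrite opprK mul_mx_scalar -[w in _ + w]scale1r -scalerDl scalerA.
    by rewrite cardA natr1 -natrM.
  by rewrite -AE.
move=> y By; rewrite mulmx_sumr big1 // => b Bb.
by rewrite mulmxBr mulmx1 wfix ?subrr // tperm_Sym.
Qed.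

(* For a symmetric [e], every edge occurs twice here too. *)
Definition graph_laplacian (e : rel T) : 'M[C]_N :=
  \sum_x star_laplacian x [set y | e y x].

(** The parts are the fibres of [k]. Singleton parts put no condition on [g] because their average
    is the identity and kills no nonzero vector; so [g = #|T|] is allowed for the complete graph. *)
Lemma multipartite_laplacian_ge (S : eqType) (k : T -> S) (g : nat) u y :
    (g <= #|T|)%N ->
    (forall x, (1 < #|[set y | k y == k x]|)%N ->
       (g + #|[set y | k y == k x]| <= #|T|)%N) ->
    u != 0 -> u *m symavg [set: T] = 0 ->
    u *m graph_laplacian (fun a b => k a != k b) = y *: u ->
  (2 * g)%:R <= y.
Proof.
set L := graph_laplacian _ => gT gk u0 uT uy.
have [/existsP[c uc]|] := boolP [exists c, u *m symavg [set z | k z == k c] != u].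
  set Q := [set z | k z == k c] in uc *.
  have Q1 : (1 < #|Q|)%N.
    by rewrite ltnNge; apply: contraNN uc => Q1; rewrite symavg_small ?mulmx1.
  have PL : symavg Q *m L = L *m symavg Q.
    apply: symavg_comm => s; rewrite inE => sQ.
    have ks z : k (s z) = k z.
      have [Qz|Qz] := boolP (z \in Q); last by rewrite (out_perm sQ).
      have : s z \in Q by rewrite (perm_closed _ sQ).
      by move: Qz; rewrite !inE => /eqP-> /eqP->.
    rewrite mulmx_sumr mulmx_suml (reindex_inj (@perm_inj _ s)) /=.
    apply: eq_bigr => x _; rewrite star_laplacianJ; congr (_ *m star_laplacian _ _).
    apply/setP=> z; apply/idP/imsetP => [|[t tx ->]]; last first.
      by move: tx; rewrite !inE !ks.
    rewrite inE => zx; exists ((s^-1)%g z); last by rewrite permKV.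
    by rewrite inE -(ks (s^-1 z)%g) permKV -(ks x).
  (* The part of [u] killed by the average over [Q] is nonzero and, by commutation, still an
     eigenvector for [y]. *)
  pose w := u - u *m symavg Q.
  have w0 : w != 0 by rewrite subr_eq0 eq_sym.
  have wQ : w *m symavg Q = 0.
    by rewrite mulmxBl -[_ *m _ *m _]mulmxA symavgM // subrr.
  have wy : w *m L = y *: w.
    by rewrite mulmxBl -mulmxA PL mulmxA uy -scalemxAl -scalerBr.
  have w_gt0 : 0 < dotmx w w by rewrite dnorm_gt0.
  rewrite -(ler_pM2r w_gt0) -[leRHS]dotmxZl -wy mulmx_sumr dotmx_suml.
  pose F b x := dotmx (w - w *m rG (tperm b x)) w.
  have F_ge0 b x : 0 <= F b x by apply: dotmx_tperm_ge0.
  have starE x B : dotmx (w *m star_laplacian x B) w = \sum_(b in B) F b x.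
    rewrite mulmx_sumr dotmx_suml; apply: eq_bigr => b _.
    by rewrite mulmxBr mulmx1.
  (* Only the edges between [Q] and its complement are kept, each from both ends; the dropped terms
     are nonnegative. *)
  apply: le_trans (_ : \sum_(x in Q) \sum_(b in ~: Q) F b x +
                       \sum_(x in ~: Q) \sum_(b in Q) F b x <= _); last first.
    rewrite [leRHS](bigID (mem Q)) /= lerD //.
      apply: ler_sum => x Qx; rewrite starE.
      rewrite [leRHS](bigID (mem (~: Q))) /= -[leLHS]addr0 lerD ?sumr_ge0 //.
      rewrite le_eqVlt; apply/orP; left; apply/eqP; apply: eq_bigl => b.
      by move: Qx; rewrite !inE => /eqP->; case: eqP.
    rewrite [leLHS](eq_bigl (fun x => x \notin Q)) => [|x]; last by rewrite inE.
    apply: ler_sum => x; rewrite inE => Qx; rewrite starE.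
    rewrite [leRHS](bigID (mem Q)) /= -[leLHS]addr0 lerD ?sumr_ge0 //.
    rewrite le_eqVlt; apply/orP; left; apply/eqP; apply: eq_bigl => b.
    by rewrite !inE; case: eqP => [->|]; rewrite ?andbF // eq_sym Qx.
  rewrite exchange_big /= [X in X + _](eq_bigr (fun x => \sum_(b in Q) F b x)).
  2: by move=> x _; apply: eq_bigr => b _; rewrite /F tpermC.
  rewrite -mulr2n -[leRHS]mulr_natl natrM -mulrA ler_pM2l ?ltr0n //.
  apply: le_trans (_ : \sum_(x in ~: Q) dotmx w w <= _); last first.
    apply: ler_sum => x; rewrite inE => Qx; rewrite -starE.
    exact: star_laplacian_ge1.
  rewrite sumr_const -[leRHS]mulr_natl ler_wpM2r ?(ltW w_gt0) // ler_nat.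
  by rewrite cardsCs setCK leq_subRL ?max_card // addnC gk.
(* Now [u] is invariant under every part, so adding the edges inside the parts does not change the
   action on [u]. *)
rewrite negb_exists => /forallP ufix.
have uL : u *m L = u *m clique_laplacian [set: T].
  rewrite !mulmx_sumr; apply: eq_big => [x|x _]; first by rewrite inE.
  rewrite !mulmx_sumr [RHS](bigID (fun b => k b == k x)) /= [X in _ = X + _]big1 ?add0r.
    by apply: eq_bigl => b; rewrite !inE.
  move=> b /andP[_ bx]; rewrite mulmxBr mulmx1.
  have /negPn/eqP ux := ufix x.
  by rewrite -{2}ux -mulmxA symavg_mul ?ux ?subrr // tperm_Sym ?inE.
have u_gt0 : 0 < dotmx u u by rewrite dnorm_gt0.
rewrite -(ler_pM2r u_gt0) -[leRHS]dotmxZl -uy uL.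
apply: le_trans (clique_laplacian_ge uT).
by rewrite ler_wpM2r ?(ltW u_gt0) // ler_nat leq_mul2l cardsT gT.
Qed.

End SymmetricGroup.

(** * Submodule representations embedded in the ambient space *)

Lemma submod_row_base (F : fieldType) (gT : finGroupType) (G : {group gT}) N
    (rG : mx_representation F G N) (U : 'M[F]_N) (Umod : mxmodule rG U) g :
  g \in G -> submod_repr Umod g *m row_base U = row_base U *m rG g.
Proof.
move=> Gg; have E m (M : 'M[F]_(m, \rank U)) : val_submod M = M *m row_base U by [].
by have := val_submodJ Umod 1%:M Gg; rewrite !E !mul1mx.
Qed.

Lemma rsim_submod_embedding (F : fieldType) (gT : finGroupType) (G : {group gT})
    N (rG : mx_representation F G N) (U : 'M[F]_N) (Umod : mxmodule rG U)
    d (T : mx_representation F G d) :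
    mx_rsim T (submod_repr Umod) ->
  exists X : 'M_(d, N),
    [/\ row_free X, (X :=: U)%MS & {in G, forall g, T g *m X = X *m rG g}].
Proof.
case=> B dE Bfree TB.
have Xfree : row_free (B *m row_base U).
  by rewrite /row_free mxrankMfree ?row_base_free.
exists (B *m row_base U); split=> // [|g Gg].
  have sXU : (B *m row_base U <= U)%MS by rewrite mulmx_sub // eq_row_base.
  by apply/eqmxP; rewrite -(mxrank_leqif_eq sXU).2 (eqP Xfree); apply/eqP.
move: (submod_repr Umod g) (row_base U) (TB g Gg) (submod_row_base Umod Gg).
by move=> S Y TS SY; rewrite mulmxA TS -(mulmxA B S) SY mulmxA.
Qed.

(** * Specht modules as right ideals of the regular representation *)

Section SpechtModules.

Variables (C : numClosedFieldType) (n : nat).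
Local Notation Sn := [set: {perm 'I_n}]%G.
Local Notation aG := (regular_repr C Sn).
Implicit Types (s t g h : {perm 'I_n}) (a : seq nat) (e : rel 'I_n).

(** The regular representation acts by permutation matrices; this provides the unitarity assumed in
    [rG_adj]. *)
Lemma regular_adj s : (aG s)^t* = aG s^-1%g.
Proof.
apply/matrixP=> i j; rewrite !mxE eqxx conjC_nat /=; congr (_%:R); congr nat_of_bool.
rewrite -(inj_eq enum_val_inj) -[RHS](inj_eq enum_val_inj) !gring_indexK ?inE //.
by rewrite -(inj_eq (mulIg s^-1%g)) mulgK eq_sym.
Qed.

Definition edges e : nat := \sum_(i < n) \sum_(j < n | (i < j)%N && e i j) 1.

Lemma graph_laplacianE e : symmetric e ->
  (forall i, e i i = false) ->
  graph_laplacian aG e = (2 * edges e)%:R%:M - 2 *: W C e.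
Proof.
move=> e_sym e_irr; pose f i j : 'M[C]_#|Sn| := 1%:M - aG (tperm i j).
have -> : graph_laplacian aG e = 2 *: \sum_(i < n) \sum_(j < n | (i < j)%N && e i j) f i j.
  rewrite scaler_nat mulr2n {2}(exchange_big_dep predT) //= -big_split /=.
  apply: eq_bigr => i _; rewrite /star_laplacian.
  rewrite [LHS](eq_bigl (e i)) => [|j]; last by rewrite inE e_sym.
  rewrite (bigID (fun j : 'I_n => (i < j)%N)) /=; congr (_ + _).
    by apply: eq_big => [j|j _]; [rewrite andbC | rewrite /f tpermC].
  apply: eq_big => [j|j _ //]; rewrite -leqNgt leq_eqVlt e_sym.
  rewrite andbC; case: eqP => [/val_inj ->|_] //=.
  by rewrite e_irr ltnn.
rewrite natrM -scalemx1 -scalerA -scalerBr; congr (_ *: _).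
rewrite /W /edges natr_sum scaler_suml -sumrB; apply: eq_bigr => i _.
rewrite natr_sum scaler_suml -sumrB; apply: eq_bigr => j _.
by rewrite scale1r.
Qed.

(** The embedding [X] intertwines [T] with right multiplication, so eigenvectors can be sought
    inside the Specht module, whatever the choice of [T]. *)
Lemma irrep_eigenvalueP a d (T : mx_representation C Sn d) e z :
    irrep_of_shape a T ->
  eigenvalue (gring_op T (W C e)) z <->
    exists u : 'rV_#|Sn|,
      [/\ u != 0, (u <= specht_mx C n a)%MS & u *m W C e = z *: u].
Proof.
case/rsim_submod_embedding=> X [Xfree XU TX].
have TW : gring_op T (W C e) *m X = X *m W C e.
  rewrite /W linear_sum mulmx_suml mulmx_sumr; apply: eq_bigr => i _.
  rewrite linear_sum mulmx_suml mulmx_sumr; apply: eq_bigr => j _.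
  by rewrite -[LHS]/(gring_op T (aG (tperm i j)) *m X) gring_opG ?TX ?inE.
split=> [/eigenvalueP[v vz v0] | [u [u0]]].
  exists (v *m X); split; first by rewrite mulmx_free_eq0.
    by rewrite -XU submxMl.
  by rewrite -mulmxA -TW mulmxA vz scalemxAl.
rewrite -XU => /submxP[v uE] uz; apply/eigenvalueP; exists v; last first.
  by apply: contraNneq u0 => v0; rewrite uE v0 mul0mx.
apply: (row_free_inj Xfree).
by rewrite -mulmxA TW mulmxA -uE uz uE scalemxAl.
Qed.

Lemma col_stab_group_set a : group_set (col_stab n a).
Proof.
apply/group_setP; split=> [|s t]; first by rewrite inE; apply/forallP=> i; rewrite perm1.
rewrite !inE => /forallP sa /forallP ta; apply/forallP=> i.
by rewrite permM (eqP (ta _)) (eqP (sa _)).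
Qed.

(** A shape other than (n) has a second row; its first entry [a1] and the entry 0 share the first
    column and can be swapped. *)
Lemma col_stab_odd a : is_intpart n a -> a <> [:: n] -> (1 < n)%N ->
  exists2 t, t \in col_stab n a & odd_perm t.
Proof.
move=> /and3P[_ a0 /eqP an] a_neq n1.
case: a => [|a1 [|a2 a]] in a0 an a_neq *.
- by rewrite -an in n1.
- by case: a_neq; rewrite -an /= addn0.
move: a0; rewrite !inE !negb_or !(eq_sym 0%N) -!lt0n => /and3P[a1_gt0 a2_gt0 _].
have a1n : (a1 < n)%N.
  by rewrite -an /= -[ltnLHS]addn0 ltn_add2l ltn_addr.
have n0 : (0 < n)%N by apply: leq_trans a1n.
set b := [:: a1, a2 & a].
have off0 : reshape_offset b 0 = 0%N by apply: (@flatten_indexKr b 0 0).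
have off1 : reshape_offset b a1 = 0%N.
  by have := @flatten_indexKr b 1 0 a2_gt0; rewrite /flatten_index /= !addn0.
exists (tperm (Ordinal n0) (Ordinal a1n)).
  rewrite inE; apply/forallP=> i.
  by case: tpermP => [->|->|//] /=; rewrite off0 off1.
by rewrite odd_tperm -val_eqE /= eq_sym -lt0n.
Qed.

Lemma sum_sign_col_stab a : is_intpart n a -> a <> [:: n] -> (1 < n)%N ->
  \sum_(s in col_stab n a) (-1) ^+ odd_perm s = 0 :> C.
Proof.
move=> ha ha' n1; have [t ta t_odd] := col_stab_odd ha ha' n1.
pose H := Group (col_stab_group_set a); have tH : t \in H by [].
set x := \sum_(s in _) _; have : x = - x.
  rewrite {1}/x (reindex_inj (mulgI t)) -sumrN /=.
  apply: eq_big => [s|s _]; first exact: (groupMl _ tH).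
  by rewrite odd_permM t_odd /= signrN.
by move/eqP; rewrite -addr_eq0 -mulr2n mulrn_eq0 /= => /eqP.
Qed.

(** Each group element acts trivially on the full average, so the column factor of the Young
    symmetrizer acts on it by its sum of signs, which is 0. *)
Lemma specht_symavg a u : is_intpart n a -> a <> [:: n] -> (1 < n)%N ->
  (u <= specht_mx C n a)%MS -> u *m symavg aG [set: 'I_n] = 0 :> 'rV_#|Sn|.
Proof.
move=> ha ha' n1 uU; set P := symavg _ _.
have gP g : aG g *m P = P by apply: mul_symavg; rewrite inE; apply/subsetP=> i; rewrite inE.
apply/sub_kermxP; apply: submx_trans uU _; apply: cyclic_mx_sub.
  apply/mxmoduleP=> g _; apply/sub_kermxP.
  by rewrite -mulmxA gP mulmx_ker.
apply/sub_kermxP; rewrite -gring_row_mul.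
have -> : young_symmetrizer C n a *m P = 0; last by rewrite linear0.
rewrite /young_symmetrizer -mulmxA [X in _ *m X](_ : _ = 0) ?mulmx0 //.
rewrite mulmx_suml (eq_bigr (fun s => (-1) ^+ odd_perm s *: P)) => [|s _].
  by rewrite -scaler_suml sum_sign_col_stab // scale0r.
by rewrite -scalemxAl gP.
Qed.

(** Row and column stabilizers meet trivially, since a cell is determined by its row and column; so
    the identity arises only as 1 * 1. This makes the Specht module nonzero. *)
Lemma young_symmetrizer_coef1 a :
  gring_row (young_symmetrizer C n a) 0 (gring_index Sn 1%g) = 1.
Proof.
have bE s : gring_row (aG s) 0 (gring_index Sn 1%g) = (s == 1%g)%:R.
  rewrite /gring_row !mxE gring_indexK ?inE // mul1g eqxx /=.
  by rewrite -(inj_eq enum_val_inj) !gring_indexK ?inE // eq_sym.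
have E : young_symmetrizer C n a =
    \sum_(s in row_stab n a) \sum_(t in col_stab n a) (-1) ^+ odd_perm t *: aG (s * t)%g.
  rewrite /young_symmetrizer mulmx_suml; apply: eq_bigr => s _.
  rewrite mulmx_sumr; apply: eq_bigr => t _.
  by rewrite -scalemxAr repr_mxM ?inE.
have rs1 : 1%g \in row_stab n a by rewrite inE; apply/forallP=> i; rewrite perm1.
have cs1 : 1%g \in col_stab n a by rewrite inE; apply/forallP=> i; rewrite perm1.
have F s t : s \in row_stab n a -> t \in col_stab n a -> (s * t == 1)%g ->
    s = 1%g /\ t = 1%g.
  rewrite !inE => /forallP sr /forallP tc /eqP st1.
  suff s1 : s = 1%g by split=> //; rewrite -st1 s1 mul1g.
  apply/permP=> i; rewrite perm1; apply: val_inj.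
  rewrite /= -(reshape_indexK a (s i)) (eqP (sr i)).
  have := tc (s i); rewrite -permM st1 perm1 => /eqP <-.
  by rewrite reshape_indexK.
rewrite E linear_sum summxE (bigD1 1%g) //= [X in _ + X]big1 ?addr0.
  rewrite linear_sum summxE (bigD1 1%g) //= [X in _ + X]big1 ?addr0.
    by rewrite linearZ mxE bE mulg1 eqxx odd_perm1 expr0 mulr1.
  move=> t /andP[tc t1]; rewrite linearZ mxE bE mul1g (negPf t1) mulr0 //.
move=> s /andP[sr s1]; rewrite linear_sum summxE big1 // => t tc.
rewrite linearZ mxE bE; case: eqP => [/eqP st|]; last by rewrite mulr0.
by case: (F _ _ sr tc st) s1 => ->; rewrite eqxx.
Qed.

Lemma specht_rank_gt0 a : (0 < \rank (specht_mx C n a))%N.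
Proof.
rewrite lt0n mxrank_eq0 cyclic_mx_eq0; apply/eqP => c0.
have := young_symmetrizer_coef1 a; rewrite c0 mxE => /eqP.
by rewrite eq_sym oner_eq0.
Qed.

End SpechtModules.

(** * The Specht module of shape (n-1,1) and the natural permutation module *)

Section HookSpechtModule.

Variables (C : numClosedFieldType) (m : nat).
Local Notation n := m.+2.
Local Notation Sn := [set: {perm 'I_n}]%G.
Local Notation aG := (regular_repr C Sn).
Implicit Types (s t g h : {perm 'I_n}) (i j : 'I_n).

(* The vectors [natural_vec i] span a copy of the natural permutation module. *)
Definition natural_vec i : 'rV[C]_#|Sn| :=
  \sum_(h : {perm 'I_n} | h ord_max == i) gring_row (aG h).

Lemma natural_vecJ i g : natural_vec i *m aG g = natural_vec (g i).
Proof.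
rewrite mulmx_suml [RHS](reindex_inj (mulIg g)) /=.
apply: eq_big => [h|h _]; first by rewrite permM (inj_eq perm_inj).
by rewrite -gring_row_mul repr_mxM ?inE.
Qed.

(** In this tableau [ord_max] sits alone in the second row. *)
Lemma row_stab_hook s : (s \in row_stab n [:: n.-1; 1%N]) = (s ord_max == ord_max).
Proof.
have idx i : reshape_index [:: m.+1; 1%N] i = (i == ord_max).
  rewrite /reshape_index /= subSS -val_eqE /=.
  have := ltn_ord i; rewrite ltnS leq_eqVlt => /predU1P[->|im].
    by rewrite subSn // subnn eqxx.
  by rewrite (ltn_eqF im) subn_eq0 -ltnS im.
rewrite inE; apply/forallP/eqP => [/(_ ord_max)|sm i].
  by rewrite !idx eqxx; case: (eqVneq (s ord_max) ord_max).
by rewrite !idx -{1}sm (inj_eq perm_inj).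
Qed.

(** The first column holds [ord0] and [ord_max]; every other column is a single cell. *)
Lemma col_stab_hook s :
  (s \in col_stab n [:: n.-1; 1%N]) = (s == 1%g) || (s == tperm ord0 ord_max).
Proof.
have off i : reshape_offset [:: m.+1; 1%N] i = if i == ord_max then 0%N else i.
  rewrite /reshape_offset /reshape_index /= subSS -val_eqE /=.
  have := ltn_ord i; rewrite ltnS leq_eqVlt => /predU1P[->|im].
    by rewrite subSnn eqxx /= addn0 subnn.
  by rewrite (ltn_eqF im) subn_eq0 -ltnS im subn0.
have neq : ord_max != ord0 :> 'I_n by [].
rewrite inE; apply/forallP/orP => [sP|[]/eqP-> i]; last 2 first.
- by rewrite perm1.
- by case: tpermP => [->|->|//]; rewrite !off /= eqxx.
have sfix i : i != ord0 -> i != ord_max -> s i = i.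
  move=> i0 im; have := sP i; rewrite !off (negPf im).
  case: (eqVneq (s i) ord_max) => [_|_ /eqP/val_inj //].
  by rewrite -val_eqE /= in i0; rewrite eq_sym (negPf i0).
have s2 i : (i == ord0) || (i == ord_max) -> (s i == ord0) || (s i == ord_max).
  move=> i2; apply: contraLR i2; rewrite !negb_or => /andP[si0 sim].
  by have := sfix _ si0 sim => /perm_inj <-; rewrite si0 sim.
have [s0|s0] := eqVneq (s ord0) ord0.
  left; apply/eqP/permP=> i; rewrite perm1.
  have [->//|i0] := eqVneq i ord0; have [im|im] := eqVneq i ord_max; last exact: sfix.
  have := s2 i; rewrite im eqxx orbT => /(_ isT)/predU1P[|/eqP //].
  by rewrite -s0 => /perm_inj /eqP; rewrite (negPf neq).
right; apply/eqP/permP=> i.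
have s0m : s ord0 = ord_max by have := s2 ord0 isT; rewrite (negPf s0) => /eqP.
case: tpermP => [->//|->|/eqP i0 /eqP im]; last exact: sfix.
have := s2 ord_max; rewrite eqxx orbT => /(_ isT).
rewrite -[X in _ || (_ == X)]s0m (inj_eq perm_inj) (negPf neq) orbF.
by move/eqP.
Qed.

Lemma young_symmetrizer_hook :
  gring_row (young_symmetrizer C n [:: n.-1; 1%N]) =
    natural_vec ord_max - natural_vec ord0.
Proof.
have tneq : tperm ord0 ord_max != 1%g :> {perm 'I_n}.
  by apply/eqP => /permP/(_ ord0); rewrite tpermL perm1.
rewrite /young_symmetrizer gring_row_mul.
have -> : gring_row (\sum_(s in row_stab n [:: n.-1; 1%N]) aG s) = natural_vec ord_max.
  by rewrite linear_sum; apply: eq_bigl => s; rewrite row_stab_hook.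
have -> : \sum_(s in col_stab n [:: n.-1; 1%N]) (-1) ^+ odd_perm s *: aG s =
    1%:M - aG (tperm ord0 ord_max).
  rewrite (eq_bigl (fun s => (s == 1%g) || (s == tperm ord0 ord_max))) => [|s].
    rewrite (bigD1 1%g) ?eqxx //= (big_pred1 (tperm ord0 ord_max)) => [|s] /=.
      by rewrite odd_perm1 odd_tperm expr0 scale1r repr_mx1 scaleN1r.
    by case: (eqVneq s 1%g) => [->|_]; rewrite ?andbT //= eq_sym (negPf tneq).
  exact: col_stab_hook.
by rewrite mulmxBr mulmx1 natural_vecJ tpermR.
Qed.

(** The generator is the difference for [ord_max] and [ord0], and double transitivity moves this
    pair to any [i], [j]. *)
Lemma natural_vec_sub i j : i != j ->
  (natural_vec i - natural_vec j <= specht_mx C n [:: n.-1; 1%N])%MS.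
Proof.
(* [x] is where the first transposition puts [ord0]; the second sends it on to [j] without moving
   [i]. *)
move=> ij; pose x := tperm ord_max i ord0.
have xi : x != i.
  rewrite /x -[X in _ != X](tpermL ord_max i) (inj_eq perm_inj).
  by [].
pose g := (tperm ord_max i * tperm x j)%g.
have gm : g ord_max = i by rewrite permM tpermL tpermD // eq_sym.
have g0 : g ord0 = j by rewrite permM tpermL.
apply/cyclic_mxP; exists (aG g); first by apply: envelop_mx_id; rewrite inE.
by rewrite young_symmetrizer_hook mulmxBl !natural_vecJ gm g0.
Qed.

Lemma natural_vec_neq i j : i != j -> natural_vec i - natural_vec j != 0.
Proof.
move=> ij; pose h := tperm ord_max i.
have E k : natural_vec k 0 (gring_index Sn h) = (k == i)%:R.
  have b s : gring_row (aG s) 0 (gring_index Sn h) = (s == h)%:R.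
    rewrite /gring_row !mxE gring_indexK ?inE // mul1g eqxx /=.
    by rewrite -(inj_eq enum_val_inj) !gring_indexK ?inE // eq_sym.
  rewrite summxE; under eq_bigr => s _ do rewrite b.
  rewrite -natr_sum; congr (_%:R); rewrite big_mkcond (bigD1 h) //= eqxx.
  rewrite big1 ?addn0 => [|s /negPf->]; last by case: ifP.
  by rewrite tpermL eq_sym; case: eqP.
apply/eqP => /rowP/(_ (gring_index Sn h)); rewrite !mxE !E eqxx eq_sym (negPf ij).
by rewrite subr0 => /eqP; rewrite oner_eq0.
Qed.

(** Only edges at [i] move this vector; each is met once in the star of [i] and once in that of the
    neighbour. *)
Lemma natural_vec_laplacian (e : rel 'I_n) i : symmetric e -> ~~ e i i ->
  natural_vec i *m graph_laplacian aG e =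
    2 *: \sum_(j | e j i) (natural_vec i - natural_vec j).
Proof.
move=> e_sym e_irr; rewrite scaler_nat mulr2n mulmx_sumr (bigD1 i) //=; congr (_ + _).
  rewrite mulmx_sumr; apply: eq_big => [j|j _]; first by rewrite inE.
  by rewrite mulmxBr mulmx1 natural_vecJ tpermR.
rewrite [RHS]big_mkcond [RHS](bigD1 i) //= (negPf e_irr) add0r.
apply: eq_bigr => x xi; rewrite mulmx_sumr [LHS]big_mkcond (bigD1 i) //= inE e_sym.
rewrite mulmxBr mulmx1 natural_vecJ tpermL big1 ?addr0 // => y yi; case: ifP => // _.
by rewrite mulmxBr mulmx1 natural_vecJ tpermD // subrr.
Qed.

End HookSpechtModule.

(** * Existence of a largest real eigenvalue *)

Section LargestEigenvalue.

Variable R : realType.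

Lemma seq_max (s : seq R) : s != [::] -> exists2 l, l \in s & {in s, forall x, x <= l}.
Proof.
case: s => // x s _; elim: s x => [|y s IHs] x.
  by exists x; rewrite ?mem_head // => y; rewrite inE => /eqP->.
have [l ls lmax] := IHs y; have [xl|lx] := leP x l.
  by exists l; [rewrite inE ls orbT | move=> z /predU1P[->|/lmax]].
exists x; first exact: mem_head.
by move=> z /predU1P[->//|/lmax/le_trans]; apply; apply: ltW.
Qed.

(** In the partial order of [R[i]], lying below a real number forces an eigenvalue to be real; the
    finitely many roots of the characteristic polynomial then have a maximum. *)
Lemma is_lambda_max_exists d (A : 'M[R[i]]_d) (L : R) : (0 < d)%N ->
    (forall z, eigenvalue A z -> z <= L%:C%C) ->
  exists l, is_lambda_max A l.
Proof.
move=> d_gt0 A_le; have [z0 z0A] := eigenvalue_closed A d_gt0.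
have [r rE] := closed_field_poly_normal (char_poly A).
have eigE z : eigenvalue A z = (z \in r).
  rewrite eigenvalue_root_char rE rootZ ?root_prod_XsubC //.
  by rewrite lead_coef_eq0 monic_neq0 ?char_poly_monic.
have realE z : z \in r -> z = (complex.Re z)%:C%C.
  rewrite -eigE => /A_le; case: z => a b; rewrite lecE /= => /andP[/eqP <- _] //.
have : [seq complex.Re z | z <- r] != [::].
  by move: z0A; rewrite eigE; case: (r).
case/seq_max=> l /mapP[z zr ->] lmax; exists (complex.Re z); split.
  by rewrite -(realE z zr) eigE.
move=> w; rewrite eigE => wr; rewrite (realE w wr) lecR.
by apply: lmax; apply: map_f.
Qed.

End LargestEigenvalue.

Theorem theorem3p1 (R : realType) (n : nat) (hn : (2 <= n)%N)
  (e : rel 'I_n) (he : complete_multipartite e)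
  (alpha : seq nat) (halpha : is_intpart n alpha) (hneq : alpha <> [:: n])
  (d1 : nat) (T1 : mx_representation R[i] [set: {perm 'I_n}]%G d1)
  (hT1 : irrep_of_shape alpha T1)
  (d2 : nat) (T2 : mx_representation R[i] [set: {perm 'I_n}]%G d2)
  (hT2 : irrep_of_shape [:: n.-1; 1%N] T2) :
  exists l1 l2 : R,
    [/\ is_lambda_max (gring_op T1 (W R[i] e)) l1,
        is_lambda_max (gring_op T2 (W R[i] e)) l2
      & l1 <= l2].
Proof.
case: n => [//|[//|m]] in hn e he alpha halpha hneq T1 hT1 T2 hT2 *.
set n := m.+2 in e he alpha halpha hneq T1 hT1 T2 hT2 *.
have [P [_ _ eP]] := he; pose k i := pblock P i.
have e_sym : symmetric e by move=> i j; rewrite !eP eq_sym.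
have e_irr i : e i i = false by rewrite eP eqxx.
have eE : graph_laplacian (regular_repr R[i] [set: {perm 'I_n}]%G) e =
          graph_laplacian (regular_repr R[i] [set: {perm 'I_n}]%G) (fun a b => k a != k b).
  apply: eq_bigr => x _; congr star_laplacian.
  by apply/setP=> y; rewrite !inE eP.
pose cl i := [set j | k j == k i].
pose nv i := natural_vec R[i] (i : 'I_n).
(* [g] is n minus the size of a largest part, or n if all parts are singletons. The last clause says
   that the Laplacian, each edge taken once, acts on [nv i - nv j] by [g]. *)
have [g [i [j [gn gcl ij gij]]]] : exists (g : nat) (i j : 'I_n),
    [/\ (g <= n)%N, forall x, (1 < #|cl x|)%N -> (g + #|cl x| <= n)%N, i != j &
      \sum_(y | e y i) (nv i - nv y) - \sum_(y | e y j) (nv j - nv y) =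
        g%:R *: (nv i - nv j)].
  case: (@arg_maxnP _ ord0 xpredT (fun x => #|cl x|) isT) => c _ cmax.
  have [c1|c1] := ltnP 1 #|cl c|.
    have /card_gt1P[i [j [ic jc ij]]] := c1; exists (n - #|cl c|)%N, i, j.
    have cn : (#|cl c| <= n)%N by rewrite -[X in (_ <= X)%N]card_ord max_card.
    move: (ic) (jc); rewrite !inE => /eqP ki /eqP kj.
    have card_nbr : #|[pred y | e y i]| = (n - #|cl c|)%N.
      transitivity #|~: cl c|; last by rewrite cardsCs setCK card_ord.
      by apply: eq_card => y; rewrite !inE /= eP -/(k y) -/(k i) ki.
    split=> // [|x _|].
    - exact: leq_subr.
    - by rewrite -[leqRHS](subnK cn) leq_add2l; apply: cmax.
    (* Being in the same part, [i] and [j] have the same neighbours, so the terms [nv y] cancel. *)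
    rewrite [X in _ - X](eq_bigl (fun y => e y i)) => [|y].
      rewrite -sumrB (eq_bigr (fun=> nv i - nv j)) => [|y _].
        rewrite sumr_const scaler_nat; congr (_ *+ _).
        exact: card_nbr.
      by rewrite opprB addrA subrK.
    by rewrite !eP -/(k _) -/(k _) -/(k i) ki kj.
  (* All parts are singletons and the graph is complete, so any two distinct vertices will do. *)
  have k_inj x y : k x = k y -> x = y.
    move=> kxy; have : (#|cl x| <= 1)%N by apply: leq_trans (cmax x isT) c1.
    by move/card_le1_eqP; apply; rewrite !inE ?kxy.
  exists n, ord0, ord_max; split=> // [x|].
    by move/leq_trans/(_ (cmax x isT)); rewrite ltnNge c1.
  have S i : \sum_(y | e y i) (nv i - nv y) = n%:R *: nv i - \sum_y nv y.
    rewrite scaler_nat -[X in _ *+ X]card_ord -sumr_const -sumrB.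
    rewrite [RHS](bigD1 i) //= subrr add0r; apply: eq_bigl => y.
    by rewrite eP; congr (~~ _); apply/eqP/eqP => [/k_inj|->].
  by rewrite !S opprB addrA subrK -scalerBr.
(* As W = |E| - D, the bound D >= g makes [L] an upper bound for every shape other than (n); it is
   attained for (n-1,1). *)
pose L : R := (edges e)%:R - g%:R.
have LE : L%:C%C = (edges e)%:R - g%:R :> R[i] by rewrite rmorphB !rmorph_nat.
have bound a d (T : mx_representation R[i] [set: {perm 'I_n}]%G d) z :
    is_intpart n a -> a <> [:: n] -> irrep_of_shape a T ->
    eigenvalue (gring_op T (W R[i] e)) z -> z <= L%:C%C.
  move=> ha ha' hT /(irrep_eigenvalueP _ _ hT)[u [u0 uU uz]].
  have uL : u *m graph_laplacian (regular_repr R[i] [set: {perm 'I_n}]%G)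
      (fun a b => k a != k b) = (2 * ((edges e)%:R - z)) *: u.
    rewrite -eE graph_laplacianE // mulmxBr mul_mx_scalar -scalemxAr uz.
    by rewrite scalerA -scalerBl mulrBr natrM.
  have := multipartite_laplacian_ge (@regular_adj _ _) _ _ u0
            (specht_symavg ha ha' isT uU) uL.
  move=> /(_ g); rewrite card_ord => /(_ gn gcl).
  by rewrite natrM ler_pM2l ?ltr0n // lerBrDl addrC -lerBrDl LE.
have h2 : is_intpart n [:: n.-1; 1%N] by rewrite /is_intpart /= addn1 eqxx.
have h2' : [:: n.-1; 1%N] <> [:: n] by [].
have d1_gt0 : (0 < d1)%N.
  by case: hT1 => B d1E _ _; rewrite d1E specht_rank_gt0.
have [l1 l1P] := is_lambda_max_exists d1_gt0 (fun z => @bound _ _ _ z halpha hneq hT1).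
exists l1, L; split=> //; last first.
  by have := bound _ _ _ _ halpha hneq hT1 l1P.1; rewrite lecR.
split=> [|z]; last exact: (bound _ _ _ _ h2 h2' hT2).
apply/(irrep_eigenvalueP _ _ hT2); exists (nv i - nv j).
split; [exact: natural_vec_neq | exact: natural_vec_sub |].
have := graph_laplacianE R[i] e_sym e_irr => /(congr1 (mulmx (nv i - nv j))).
rewrite mulmxBl !natural_vec_laplacian ?e_irr // -scalerBr gij.
rewrite mulmxBr mul_mx_scalar -scalemxAr natrM -scalerA -scalerBr.
(* The factor 2 from counting every edge twice is cancelled. *)
have two0 : 2 != 0 :> R[i] by rewrite pnatr_eq0.
by move=> /(scalerI two0) gE; rewrite LE scalerBl gE subKr.
Qed.
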